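(* $13\le M(12)\le 15$.
   Context: For a positive integer $n$, $\tau(n)$ denotes the number of positive divisors of $n$. For a positive integer $k$, $M(k)$ denotes the maximal length of a run of consecutive positive integers each having exactly $k$ divisors, i.e. the largest $L$ for which there is a positive integer $n$ with $\tau(n)=\tau(n+1)=\dots=\tau(n+L-1)=k$. *)

(* Defs.v *)
From mathcomp Require Import all_boot.

Set Implicit Arguments.
Unset Strict Implicit.
Unset Printing Implicit Defensive.

Definition tau (n : nat) : nat := size (divisors n).

Definition has_run (k L : nat) : Prop :=
  exists2 n : nat, 0 < n & forall i : nat, i < L -> tau (n + i) = k.

(* "M(k) = L". A relation, because for a general k the maximum is not known
   a priori to exist; the value is unique when it does. *)
Definition is_M (k L : nat) : Prop :=
  has_run k L /\ forall L' : nat, has_run k L' -> L' <= L.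

(* Main.v *)
From Stdlib Require Import NArith Classical.
Require Import Defs.
From mathcomp Require Import all_boot cyclic zify.

(** Upper bound ([run_le15]). By multiplicativity the exponents of 12-divisor
    numbers are very restricted: the exponent of a prime plus one divides 12.
    In particular such a number, if exactly divisible by 8, is 8 times an odd
    prime square, hence is 8 modulo 64. This decides the powers of 2 in its two
    neighbours at distance 8, one of which lies in every window of 16 numbers
    around it, and neither of them can have 12 divisors.

    Lower bound ([run13]). A run of 13 such numbers is exhibited; each of them
    has the shape p q^2 r or p^5 q. It was found by prescribing, with the
    Chinese remainder theorem, a square factor (or 4, or 32) in each of the 13
    numbers, together with the positions of the multiples of 3 and 5, and then
    sieving the resulting arithmetic progression for a term where the cofactors
    are prime or have two prime factors, as required. The numbers have 31
    digits, so their factorizations are checked in binary arithmetic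
    ([tau_checkP]) and the primality of the factors is established by
    Pocklington certificates ([pocklington], [check_certificatesP]).

    Between 13 and 15 the maximum is located by excluded middle: it is the
    largest of 13, 14 and 15 that is the length of a run. *)
Set Implicit Arguments.
Unset Strict Implicit.
Unset Printing Implicit Defensive.

(** * The number of divisors as a multiplicative function *)

Lemma size_add_divisors p e s :
  size (PrimeDecompAux.add_divisors (p, e) s) = e.+1 * size s.
Proof.
rewrite /PrimeDecompAux.add_divisors; elim: e => [|e IHe].
  by rewrite mul1n.
by rewrite iterS size_merge size_cat size_map IHe mulSn addnC mulSn.
Qed.

(** The list of divisors is built by folding over the prime decomposition, and
    each prime power p ^ e multiplies its length by e + 1. *)
Lemma tauE n : tau n = \prod_(p <- primes n) (logn p n).+1.
Proof.
rewrite /tau /divisors prime_decompE; elim: (primes n) => [|p ps IH].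
  by rewrite big_nil.
by rewrite big_cons -IH; exact: size_add_divisors.
Qed.

Lemma tau_coprimeM m n : 0 < m -> 0 < n -> coprime m n ->
  tau (m * n) = tau m * tau n.
Proof.
move=> m_gt0 n_gt0 co_mn.
have co_p q r p : 0 < r -> coprime q r -> p \in primes q -> coprime p r.
  by move=> r0 co_qr /[!mem_primes] /and3P[_ _ /coprime_dvdl]; apply.
have primes_mn : perm_eq (primes (m * n)) (primes m ++ primes n).
  apply: uniq_perm; rewrite ?cat_uniq ?primes_uniq //= ?andbT.
    apply/hasPn=> p pn; apply/negP=> pm.
    move: pn (co_p _ _ _ n_gt0 co_mn pm).
    rewrite mem_primes => /and3P[p_pr _ p_n].
    by rewrite prime_coprime // p_n.
  by move=> p; rewrite mem_cat primesM.
rewrite !tauE (perm_big _ primes_mn) big_cat; congr (_ * _).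
  apply: eq_big_seq => p pm.
  by rewrite mulnC logn_Gauss // (co_p _ _ _ n_gt0 co_mn pm).
apply: eq_big_seq => p pn.
by rewrite logn_Gauss // (co_p n _ _ m_gt0) // coprime_sym.
Qed.

Lemma tauX p k : prime p -> tau (p ^ k) = k.+1.
Proof.
move=> p_pr; rewrite tauE; case: k => [|k]; first by rewrite big_nil.
by rewrite primesX // primes_prime // big_seq1 pfactorK.
Qed.

Lemma tau_pfactor p k m : prime p -> 0 < m -> coprime p m ->
  tau (p ^ k * m) = k.+1 * tau m.
Proof.
move=> p_pr m_gt0 co_pm.
by rewrite tau_coprimeM ?tauX // ?expn_gt0 ?prime_gt0 // coprimeXl.
Qed.

Lemma tau_prod_pfactors (s : seq (nat * nat)) :
    uniq (unzip1 s) -> all prime (unzip1 s) ->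
  tau (\prod_(f <- s) f.1 ^ f.2) = \prod_(f <- s) f.2.+1.
Proof.
elim: s => [|[p k] s IH] /=; first by rewrite !big_nil.
case/andP=> p_s uniq_s /andP[p_pr s_pr]; rewrite !big_cons /= -IH //.
have s_gt0 : 0 < \prod_(f <- s) f.1 ^ f.2.
  rewrite big_seq; apply: prodn_cond_gt0 => f fs.
  by rewrite expn_gt0 prime_gt0 // (allP s_pr) ?map_f.
rewrite tau_pfactor // big_seq; elim/big_ind: _ => [|x y px py|f fs].
- exact: coprimen1.
- by rewrite coprimeMr px.
have f_pr : prime f.1 by rewrite (allP s_pr) ?map_f.
rewrite coprimeXr // prime_coprime // dvdn_prime2 //.
by apply: contra p_s => /eqP->; rewrite map_f.
Qed.

Lemma tau_split p n : prime p -> 0 < n ->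
  exists m, [/\ 0 < m, n = p ^ logn p n * m
               & tau n = (logn p n).+1 * tau m].
Proof.
move=> p_pr n_gt0; have [m co_pm def_n] := pfactor_coprime p_pr n_gt0.
have m_gt0 : 0 < m by move: n_gt0; rewrite def_n muln_gt0 => /andP[].
by exists m; rewrite -(tau_pfactor _ p_pr) // mulnC -def_n.
Qed.

Lemma tau_gt1 n : 1 < n -> 1 < tau n.
Proof.
move=> n_gt1.
have [m [m_gt0 _ ->]] := tau_split (pdiv_prime n_gt1) (ltnW n_gt1).
have: 0 < logn (pdiv n) n by rewrite logn_gt0 pi_pdiv.
have: 0 < tau m by rewrite tauE prodn_gt0.
nia.
Qed.

Lemma tau3_square n : 0 < n -> tau n = 3 -> exists p, n = p ^ 2.
Proof.
move=> n_gt0 tau3; have n_gt1 : 1 < n by case: n n_gt0 tau3 => [|[]].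
have [m [m_gt0]] := tau_split (pdiv_prime n_gt1) n_gt0.
have := logn_gt0 (pdiv n) n; rewrite pi_pdiv n_gt1 tau3.
move: (logn _ _) => k k_gt0 def_n {}tau3.
have [m_lt1|/tau_gt1 tau_m|m1] := ltngtP m 1.
- lia.
- by have := leq_mul (k_gt0 : 2 <= k.+1) tau_m; rewrite -tau3.
by exists (pdiv n); rewrite {1}def_n; move: tau3; rewrite m1 !muln1 => -[<-].
Qed.

(** * Runs of numbers with twelve divisors have length at most 15 *)

(** Among 16 consecutive numbers one is x = 8 u with u odd. From tau x = 12
    follows tau u = 3, so u is an odd square and x = 8 mod 64. Then x + 8 is 16
    times an odd number, so tau (x + 8) is a multiple of 5; and x - 8 is a
    multiple of 64, so tau (x - 8) = 12 forces x - 8 = 2 ^ 11, that is u = 257,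
    which is not a square. One of x - 8 and x + 8 is among the 16 numbers. *)
Lemma run_le15 L : has_run 12 L -> L <= 15.
Proof.
case=> n n_gt0 run_n; rewrite leqNgt; apply/negP=> L_ge16.
have {}run_n x : n <= x < n + 16 -> tau x = 12.
  by move=> x_in; rewrite -(run_n (x - n)) ?subnKC; lia.
have [m x_in] : exists m, n <= 8 * m.*2.+1 < n + 16.
  by exists ((n + 7) %/ 16); lia.
have [p def_m] : exists p, m.*2.+1 = p ^ 2.
  apply: tau3_square => //; move: (run_n _ x_in).
  by rewrite (@tau_pfactor 2 3) ?coprime2n /= ?odd_double //; lia.
have odd_p : odd p by move/(congr1 odd): def_m; rewrite oddX /= odd_double.
have [j p2E] : exists j, p ^ 2 = 8 * j + 1.
  exists (p./2 * p./2.+1)./2; have := odd_double_half p.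
  have: (p./2 * p./2.+1)./2.*2 = p./2 * p./2.+1.
    by rewrite even_halfK // oddM /= andbN.
  by rewrite odd_p; nia.
(* x + 8 = 2 ^ 4 * (4 j + 1), and x - 8 = 64 j. *)
have [lt_x | le_x] := ltnP (8 * m.*2.+1 + 8) (n + 16).
  have: tau (2 ^ 4 * (4 * j).+1) = 12 by apply: run_n; lia.
  by rewrite tau_pfactor ?coprime2n /= ?oddM //; lia.
have y_gt0 : 0 < 8 * m.*2.+1 - 8 by lia.
have v_ge6 : 6 <= logn 2 (8 * m.*2.+1 - 8).
  by rewrite -pfactor_dvdn //; apply/dvdnP; exists j; lia.
have [i [i_gt0]] := @tau_split 2 _ isT y_gt0.
rewrite run_n; last lia.
move: (logn _ _) v_ge6 => v v_ge6 def_y tau12.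
have [i_lt1|/tau_gt1 tau_i|i1] := ltngtP i 1; first lia.
  by have := leq_mul (v_ge6 : 7 <= v.+1) tau_i; rewrite -tau12.
move: tau12 def_y; rewrite i1 !muln1 => -[<-].
have [|] := leqP p 16; have -> : 2 ^ 11 = 2048 by []; nia.
Qed.

(** * The Pocklington primality criterion *)

Lemma expnM_mod1 x m k p : x ^ m = 1 %[mod p] -> x ^ (m * k) = 1 %[mod p].
Proof. by move=> xm1; rewrite expnM -modnXm xm1 modnXm exp1n. Qed.

Lemma expn_gcd_mod1 x m n p : 0 < m ->
  x ^ m = 1 %[mod p] -> x ^ n = 1 %[mod p] -> x ^ gcdn m n = 1 %[mod p].
Proof.
move=> m_gt0 xm1 xn1; have [km kn def_km _] := egcdnP n m_gt0.
rewrite -(expnM_mod1 km xm1) (mulnC m) def_km expnD -modnMml mulnC.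
by rewrite mulnC (mulnC kn) (expnM_mod1 kn xn1) modnMml mul1n.
Qed.

(** The order of b = a ^ (q.-1 / F) modulo p is exactly F: it divides F, and if
    it divided F / f for a prime f dividing F, then a ^ (q.-1 / f) would be 1
    modulo p, against the coprimality hypothesis. By
    Fermat this order divides p - 1. In place of the order of b the proof uses
    gcdn F p.-1, which is also an exponent that kills b. *)
Lemma pocklington_factor q F a p : 1 < q -> 0 < F -> F %| q.-1 ->
    a ^ q.-1 = 1 %[mod q] ->
    (forall f, prime f -> f %| F -> coprime (a ^ (q.-1 %/ f) %% q).-1 q) ->
  prime p -> p %| q -> F %| p.-1.
Proof.
move=> q_gt1 F_gt0 /dvdnP[c def_q] aq1 coF p_pr p_q.
have mod_p x y : x = y %[mod q] -> x = y %[mod p].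
  by move=> exy; rewrite -(modn_dvdm x p_q) exy modn_dvdm.
have ap1 : a ^ p.-1 = 1 %[mod p].
  rewrite -totient_prime //; apply: Euler_exp_totient.
  have q1_gt0 : 0 < q.-1 by lia.
  rewrite -(coprime_pexpl _ _ q1_gt0) -coprime_modl (mod_p _ _ aq1).
  by rewrite coprime_modl coprime1n.
have bF1 : (a ^ c) ^ F = 1 %[mod p] by rewrite -expnM -def_q; apply: mod_p.
have bp1 : (a ^ c) ^ p.-1 = 1 %[mod p].
  by rewrite -expnM mulnC; apply: expnM_mod1.
have bd1 := expn_gcd_mod1 F_gt0 bF1 bp1.
have [e def_F] := dvdnP (dvdn_gcdl F p.-1).
have e_gt0 : 0 < e by case: e def_F => // F0; rewrite F0 in F_gt0.
have [e_le1 | e_gt1] := leqP e 1.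
  have e1 : e = 1 by lia.
  by rewrite def_F e1 mul1n dvdn_gcdr.
(* Otherwise the killing exponent divides F / f for a prime divisor f of e. *)
have f_pr := pdiv_prime e_gt1; have [e' def_e] := dvdnP (pdiv_dvd e).
move: (pdiv e) f_pr def_e => f f_pr def_e.
have f_F : f %| F by rewrite def_F def_e -mulnAC dvdn_mull.
have := coF f f_pr f_F.
have ->: q.-1 = c * gcdn F p.-1 * e' * f.
  by rewrite def_q {1}def_F def_e; lia.
rewrite mulnK ?prime_gt0 //.
have := mod_p _ _ (modn_mod (a ^ (c * gcdn F p.-1 * e')) q).
set r := _ %% q => rE co_r.
have {}rE : r = 1 %[mod p].
  by rewrite rE -mulnA expnM; apply: expnM_mod1.
have r_gt0 : 0 < r.
  by move: co_r; rewrite lt0n; case: eqP => // ->; rewrite /coprime gcd0n; lia.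
suffices: p %| gcdn r.-1 q.
  by rewrite (eqP co_r) dvdn1 => /eqP p1; rewrite p1 in p_pr.
rewrite dvdn_gcd p_q andbT -subn1 -eqn_mod_dvd //.
exact/eqP.
Qed.

(** The least prime factor of q exceeds F, hence exceeds the square root of q. *)
Lemma pocklington q F a : 1 < q -> F %| q.-1 -> q < F ^ 2 ->
    a ^ q.-1 = 1 %[mod q] ->
    (forall f, prime f -> f %| F -> coprime (a ^ (q.-1 %/ f) %% q).-1 q) ->
  prime q.
Proof.
move=> q_gt1 F_q1 ltqFF aq1 coF.
have F_gt0 : 0 < F by case: F ltqFF {F_q1 coF}.
have p_pr := pdiv_prime q_gt1.
have := pocklington_factor q_gt1 F_gt0 F_q1 aq1 coF p_pr (pdiv_dvd q).
move/dvdn_leq; have := prime_gt1 p_pr => p_gt1 le_F.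
apply: (ltn_pdiv2_prime (ltnW q_gt1)); apply: (leq_trans ltqFF).
by rewrite leq_exp2r //; lia.
Qed.

(** * Certificates checked in binary arithmetic *)

Lemma nat_of_bin_divmod (a b : N) : (b <> 0)%num ->
  (N.div a b = a %/ b :> nat) * (N.modulo a b = a %% b :> nat).
Proof.
move=> b0; have lt_r : nat_of_bin (N.modulo a b) < b.
  by have := N.mod_lt a b b0; lia.
have -> : nat_of_bin a = N.div a b * b + N.modulo a b.
  by have := N.div_mod a b b0; lia.
by rewrite divnMDl ?modnMDl ?divn_small ?modn_small ?addn0 //; lia.
Qed.

Lemma nat_of_bin_pred (a : N) : N.pred a = a.-1 :> nat.
Proof. lia. Qed.

Lemma nat_of_bin_mul (a b : N) : N.mul a b = a * b :> nat.
Proof. lia. Qed.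

Fixpoint powmod_pos (m a : N) (e : positive) : N :=
  match e with
  | xH => N.modulo a m
  | xO e' => let b := powmod_pos m a e' in N.modulo (N.mul b b) m
  | xI e' => let b := powmod_pos m a e' in N.modulo (N.mul (N.mul b b) a) m
  end.

Definition powmod (m a e : N) : N :=
  if e is Npos p then powmod_pos m a p else N.modulo 1%num m.

Lemma powmodE m a e : (m <> 0)%num -> powmod m a e = a ^ e %% m :> nat.
Proof.
move=> m0; have modE c := (nat_of_bin_divmod c m0).2.
case: e => [|e] /=; first by rewrite modE.
elim: e => [e IH|e IH|] /=; rewrite modE ?nat_of_bin_mul ?IH ?NatTrec.doubleE.
- by rewrite expnS mulnC -modnMmr modnMm modnMmr -expnD addnn.
- by rewrite modnMm -expnD addnn.
- by rewrite expn1.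
Qed.

Definition Nprod (fs : seq (N * nat)) : N :=
  foldr (fun f n => N.mul (iter f.2 (N.mul f.1) 1%num) n) 1%num fs.

Lemma nat_of_bin_prod fs :
  Nprod fs = \prod_(f <- fs) nat_of_bin f.1 ^ f.2 :> nat.
Proof.
have powE (p : N) e : iter e (N.mul p) 1%num = p ^ e :> nat.
  by elim: e => //= e IH; rewrite nat_of_bin_mul IH expnS.
elim: fs => [|f fs IH]; first by rewrite big_nil.
by rewrite big_cons /= nat_of_bin_mul powE IH.
Qed.

Definition Nprime (q : N) : bool := prime q.

Lemma prime_dvd_Nprod p fs : prime p -> all Nprime (unzip1 fs) ->
  p %| Nprod fs -> exists2 f : N, f \in unzip1 fs & p = f.
Proof.
rewrite nat_of_bin_prod => p_pr; elim: fs => [_|[f e] fs IH] /=.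
  by rewrite big_nil dvdn1 => /eqP p1; rewrite p1 in p_pr.
case/andP=> f_pr fs_pr; rewrite big_cons Euclid_dvdM // => /orP[].
  rewrite Euclid_dvdX // => /andP[+ _]; rewrite dvdn_prime2 // => /eqP->.
  by exists f; rewrite ?mem_head.
by move=> /IH[//|h h_fs ->]; exists h; rewrite // inE h_fs orbT.
Qed.

Lemma Ngcd1_coprime (x y : N) : N.gcd x y = 1%num -> coprime x y.
Proof.
have bezout (u v : N) : N.Bezout u v 1 -> coprime u v.
  case=> a [b def1]; rewrite /coprime -dvdn1.
  rewrite -(dvdn_addl 1 (dvdn_mull b (dvdn_gcdr u v))).
  suff -> : 1 + b * v = a * u by rewrite dvdn_mull ?dvdn_gcdl.
  lia.
(* Bezout relations over N avoid subtraction, so either sign may occur. *)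
case: (N.gcd_bezout x y) => [+ e1|+ e1]; rewrite e1 => /bezout //.
by rewrite coprime_sym.
Qed.

(** A triple (q, a, fs): the primes of fs and their exponents give the factored
    part F of q - 1, and a is the base of the criterion. *)
Definition certificate : Type := N * N * seq (N * nat).

(** Truncated subtraction is harmless in [witness]: if the power is 0 modulo q,
    then its predecessor 0 has gcd q with q, and the check fails as it must. *)
Definition pocklington_check (c : certificate) : bool :=
  let: (q, a, fs) := c in
  let F := Nprod fs in
  let witness f := N.pred (powmod q a (N.div (N.pred q) f)) in
  [&& N.ltb 1 q, N.ltb q (N.mul F F), N.modulo (N.pred q) F == 0%num,
      powmod q a (N.pred q) == 1%num
    & all (fun f => N.gcd (witness f) q == 1%num) (unzip1 fs)].

Lemma pocklington_checkP q a fs :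
  all Nprime (unzip1 fs) -> pocklington_check (q, a, fs) -> Nprime q.
Proof.
move=> fs_pr /and5P[q_gt1 ltqFF F_q1 /eqP aq1 /allP fs_ok].
have q0 : (q <> 0)%num by lia.
have F0 : (Nprod fs <> 0)%num by lia.
apply: (@pocklington q (Nprod fs) a); first lia.
- by rewrite /dvdn -nat_of_bin_pred -(nat_of_bin_divmod _ F0).2 (eqP F_q1).
- by rewrite expnS expn1 -nat_of_bin_mul; lia.
- by rewrite -nat_of_bin_pred -powmodE // aq1 modn_small; lia.
move=> p p_pr /(prime_dvd_Nprod p_pr fs_pr)[f f_fs ->] {p p_pr}.
have f0 : (f <> 0)%num by move=> f0; have := allP fs_pr f f_fs; rewrite f0.
have /eqP/Ngcd1_coprime := fs_ok _ f_fs.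
by rewrite nat_of_bin_pred powmodE // (nat_of_bin_divmod _ f0).1 nat_of_bin_pred.
Qed.

(** Listing the certificates with the largest prime first makes the primes that
    a certificate relies on members of the tail; 2 is the base case. *)
Definition certified (cs : seq certificate) : seq N :=
  2%num :: [seq c.1.1 | c <- cs].

Fixpoint check_certificates (cs : seq certificate) : bool :=
  if cs is c :: cs' then
    [&& all (mem (certified cs')) (unzip1 c.2), pocklington_check c
      & check_certificates cs']
  else true.

Lemma check_certificatesP cs :
  check_certificates cs -> all Nprime (certified cs).
Proof.
elim: cs => [|[[q a] fs] cs IH] //= /and3P[/allP fs_cs q_ok /IH/= cs_pr].
rewrite cs_pr andbT; apply: pocklington_checkP q_ok.
by apply/allP=> f /fs_cs; apply/allP.
Qed.

Definition tau_check (ps : seq N) (k : nat) (n : N) (fs : seq (N * nat)) :=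
  [&& uniq (unzip1 fs), all (mem ps) (unzip1 fs), n == Nprod fs
    & foldr muln 1 [seq f.2.+1 | f <- fs] == k].

Lemma tau_checkP ps k n fs :
  all Nprime ps -> tau_check ps k n fs -> tau n = k.
Proof.
move=> /allP ps_pr /and4P[uniq_fs /allP fs_ps /eqP-> /eqP<-].
pose gs := [seq (nat_of_bin f.1, f.2) | f <- fs].
have gs1 : unzip1 gs = map nat_of_bin (unzip1 fs).
  by rewrite /unzip1 -!map_comp.
have -> : nat_of_bin (Nprod fs) = \prod_(g <- gs) g.1 ^ g.2.
  by rewrite nat_of_bin_prod big_map.
rewrite tau_prod_pfactors ?gs1.
- by rewrite foldrE !big_map.
- by rewrite map_inj_uniq //; apply: can_inj nat_of_binK.
by rewrite all_map; apply/allP=> p /fs_ps/ps_pr.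
Qed.

Definition run_check cs (k : nat) (n : N) (fss : seq (seq (N * nat))) : bool :=
  check_certificates cs &&
  all (fun i => tau_check (certified cs) k (N.add n (bin_of_nat i))
                          (nth [::] fss i))
      (iota 0 (size fss)).

Lemma run_checkP cs k n fss :
  n != 0%num -> run_check cs k n fss -> has_run k (size fss).
Proof.
move=> n0 /andP[/check_certificatesP cs_pr /allP fss_ok].
exists n; first by lia.
move=> i i_lt; have -> : nat_of_bin n + i = N.add n (bin_of_nat i).
  by rewrite -{1}(bin_of_natK i); lia.
by apply: tau_checkP cs_pr (fss_ok i _); rewrite mem_iota.
Qed.

(** * A run of thirteen numbers with twelve divisors *)

(** This number is 25 modulo 64, so the only multiple of 8 in the run is the
    eighth term, which is exactly divisible by 32: the run avoids both the
    multiples of 64 and the numbers exactly divisible by 8 or by 16. *)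
Definition run_start : N := 4090670625676154104132054464217%num.

(** Few and large prime factors of q - 1 are used in each certificate: every one
    of them costs a modular exponentiation at the size of q. *)
Definition certificates : seq certificate :=
  ([:: (340889218806346175344337872019, 2, [:: (56710150104401593573, 1%nat)]);
     (227259479204230783562891914679, 2, [:: (3018039041897927, 1%nat)]);
     (204533531283807705206602723211, 2, [:: (4568059684049, 1%nat); (6257, 1%nat)]);
     (127833457052379815754126702007, 2, [:: (1165264630013273, 1%nat)]);
     (54542275009015388055094059523, 2, [:: (9090379168169231342515676587, 1%nat)]);
     (9090379168169231342515676587, 2, [:: (306728274649226281, 1%nat)]);
     (7077284819508917135176564817, 2, [:: (595330149689511872070707, 1%nat)]);
     (3866418360752508605039749021, 2, [:: (5732613291748226143937, 1%nat)]);
     (3777165859350096125699034593, 2, [:: (3190173867694337944002563, 1%nat)]);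
     (7377769367394440534164031, 2, [:: (889952476414559, 1%nat)]);
     (5521061794275171177672187, 3, [:: (364891114531, 1%nat); (3, 2%nat)]);
     (3190173867694337944002563, 2, [:: (8790924809157324023, 1%nat)]);
     (595330149689511872070707, 2, [:: (5013418395589, 1%nat)]);
     (5732613291748226143937, 3, [:: (2844149071, 1%nat); (2, 5%nat)]);
     (56710150104401593573, 2, [:: (20063419, 1%nat); (1051, 1%nat)]);
     (40181526713459872061, 2, [:: (37907100673075351, 1%nat)]);
     (8790924809157324023, 2, [:: (16970897314975529, 1%nat)]);
     (306728274649226281, 2, [:: (1219671373, 1%nat)]);
     (41879745244033831, 2, [:: (9496540871663, 1%nat)]);
     (37907100673075351, 2, [:: (1165617367, 1%nat)]);
     (16970897314975529, 2, [:: (1208993791, 1%nat)]);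
     (3018039041897927, 2, [:: (40784311376999, 1%nat)]);
     (1165264630013273, 3, [:: (5282653, 1%nat); (2, 3%nat)]);
     (889952476414559, 2, [:: (444976238207279, 1%nat)]);
     (444976238207279, 2, [:: (222488119103639, 1%nat)]);
     (240606405224807, 2, [:: (5030028959, 1%nat)]);
     (222488119103639, 2, [:: (7334611957, 1%nat)]);
     (100600612060199, 2, [:: (10242461, 1%nat)]);
     (40784311376999, 2, [:: (181253, 1%nat); (41, 1%nat)]);
     (9496540871663, 2, [:: (365251571987, 1%nat)]);
     (5013418395589, 2, [:: (417784866299, 1%nat)]);
     (4568059684049, 3, [:: (179947, 1%nat); (2, 4%nat)]);
     (1993399757017, 2, [:: (323184137, 1%nat)]);
     (417784866299, 2, [:: (2539633, 1%nat)]);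
     (365251571987, 2, [:: (15187, 1%nat); (7, 2%nat)]);
     (364891114531, 2, [:: (76497089, 1%nat)]);
     (7334611957, 2, [:: (1265461, 1%nat)]);
     (5030028959, 2, [:: (2515014479, 1%nat)]);
     (2844149071, 2, [:: (5437, 1%nat); (53, 1%nat)]);
     (2515014479, 2, [:: (5009989, 1%nat)]);
     (1219671373, 2, [:: (217643, 1%nat)]);
     (1208993791, 2, [:: (93503, 1%nat)]);
     (1165617367, 3, [:: (27091, 1%nat); (2, 1%nat)]);
     (841361641, 2, [:: (1001621, 1%nat)]);
     (323184137, 2, [:: (3672547, 1%nat)]);
     (76497089, 2, [:: (38557, 1%nat)]);
     (20063419, 3, [:: (1721, 1%nat); (3, 1%nat)]);
     (10242461, 2, [:: (7213, 1%nat)]);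
     (5282653, 2, [:: (440221, 1%nat)]);
     (5009989, 2, [:: (4691, 1%nat)]);
     (3672547, 2, [:: (71, 1%nat); (37, 1%nat)]);
     (2539633, 5, [:: (157, 1%nat); (2, 4%nat)]);
     (1265461, 2, [:: (131, 1%nat); (23, 1%nat)]);
     (1001621, 2, [:: (821, 1%nat); (2, 1%nat)]);
     (440221, 2, [:: (29, 1%nat); (23, 1%nat)]);
     (217643, 2, [:: (108821, 1%nat)]);
     (181253, 2, [:: (113, 1%nat); (2, 2%nat)]);
     (179947, 2, [:: (769, 1%nat)]);
     (108821, 2, [:: (5441, 1%nat)]);
     (93503, 2, [:: (46751, 1%nat)]);
     (46751, 11, [:: (5, 3%nat); (2, 1%nat)]);
     (38557, 2, [:: (3, 4%nat); (2, 2%nat)]);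
     (27091, 2, [:: (43, 1%nat); (3, 2%nat)]);
     (15187, 2, [:: (2531, 1%nat)]);
     (7213, 2, [:: (601, 1%nat)]);
     (6257, 3, [:: (17, 1%nat); (2, 3%nat)]);
     (5441, 3, [:: (5, 1%nat); (2, 4%nat)]);
     (5437, 2, [:: (151, 1%nat)]);
     (4691, 2, [:: (67, 1%nat); (2, 1%nat)]);
     (2531, 2, [:: (11, 1%nat); (5, 1%nat)]);
     (1721, 2, [:: (43, 1%nat)]);
     (1051, 2, [:: (5, 2%nat); (2, 1%nat)]);
     (881, 3, [:: (5, 1%nat); (2, 3%nat)]);
     (821, 2, [:: (41, 1%nat)]);
     (769, 7, [:: (2, 5%nat)]);
     (601, 2, [:: (5, 2%nat)]);
     (251, 3, [:: (5, 2%nat)]);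
     (157, 2, [:: (13, 1%nat)]);
     (151, 3, [:: (5, 2%nat)]);
     (131, 2, [:: (13, 1%nat)]);
     (113, 3, [:: (2, 4%nat)]);
     (71, 7, [:: (5, 1%nat); (2, 1%nat)]);
     (67, 2, [:: (11, 1%nat)]);
     (53, 2, [:: (13, 1%nat)]);
     (47, 2, [:: (23, 1%nat)]);
     (43, 2, [:: (7, 1%nat)]);
     (41, 3, [:: (2, 3%nat)]);
     (37, 2, [:: (3, 2%nat)]);
     (29, 2, [:: (7, 1%nat)]);
     (23, 2, [:: (11, 1%nat)]);
     (19, 2, [:: (3, 2%nat)]);
     (17, 3, [:: (2, 3%nat)]);
     (13, 2, [:: (2, 2%nat)]);
     (11, 2, [:: (5, 1%nat)]);
     (7, 2, [:: (3, 1%nat)]);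
     (5, 2, [:: (2, 2%nat)]);
     (3, 2, [:: (2, 1%nat)])])%num.

Definition factorizations : seq (seq (N * nat)) :=
  ([:: [:: (13, 2%nat); (100600612060199, 1%nat); (240606405224807, 1%nat)];
     [:: (2, 1%nat); (23, 2%nat); (3866418360752508605039749021, 1%nat)];
     [:: (3, 1%nat); (19, 2%nat); (3777165859350096125699034593, 1%nat)];
     [:: (2, 2%nat); (5, 1%nat); (204533531283807705206602723211, 1%nat)];
     [:: (11, 2%nat); (841361641, 1%nat); (40181526713459872061, 1%nat)];
     [:: (2, 1%nat); (3, 2%nat); (227259479204230783562891914679, 1%nat)];
     [:: (7, 2%nat); (1993399757017, 1%nat); (41879745244033831, 1%nat)];
     [:: (2, 5%nat); (127833457052379815754126702007, 1%nat)];
     [:: (3, 1%nat); (5, 2%nat); (54542275009015388055094059523, 1%nat)];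
     [:: (2, 1%nat); (17, 2%nat); (7077284819508917135176564817, 1%nat)];
     [:: (29, 2%nat); (881, 1%nat); (5521061794275171177672187, 1%nat)];
     [:: (2, 2%nat); (3, 1%nat); (340889218806346175344337872019, 1%nat)];
     [:: (47, 2%nat); (251, 1%nat); (7377769367394440534164031, 1%nat)]])%num.

Lemma run13 : has_run 12 13.
Proof.
by apply: (@run_checkP certificates 12 run_start factorizations); vm_compute.
Qed.

Theorem lemma6 : exists2 m : nat, is_M 12 m & 13 <= m <= 15.
Proof.
have is_M12 m : has_run 12 m -> (forall L, m < L <= 15 -> ~ has_run 12 L) ->
    is_M 12 m.
  move=> run_m no_longer; split=> // L run_L; rewrite leqNgt; apply/negP=> m_lt.
  by apply: (no_longer L _ run_L); rewrite m_lt (run_le15 run_L).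
have [run15|no15] := classic (has_run 12 15).
  by exists 15 => //; apply: is_M12 => // L L_in; lia.
have [run14|no14] := classic (has_run 12 14).
  by exists 14 => //; apply: is_M12 => // L L_in; have -> : L = 15 by lia.
exists 13 => //; apply: (is_M12 _ run13) => L L_in.
by have [->|->] : L = 14 \/ L = 15 by lia.
Qed.
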